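(* Let $P$ be a property of positive integers. For a property $Q$ let $f_Q(n)$ denote the $n$-th smallest positive integer $m$ such that $Q(m)$ holds, and let $C_Q(n)=|\{m\in\mathbb{N}: 1\le m\le n,\ Q(m)\}|$. Suppose that infinitely many positive integers fail $P$ and that $f_{\neg P}(m+1)-f_{\neg P}(m)\geq m$ for all positive integers $m$. Then for every positive integer $n$, $$f_P(n)=\begin{cases} n+C_{\neg P}(n)+1 & \text{if } n+C_{\neg P}(n)\geq f_{\neg P}(C_{\neg P}(n)+1),\\ n+C_{\neg P}(n) & \text{otherwise.}\end{cases}$$
   Context: $\neg P$ denotes the negation of $P$, so $f_{\neg P}(n)$ is the $n$-th smallest positive integer not satisfying $P$, and $C_{\neg P}(n)=n-C_P(n)$ is the number of integers in $\{1,\dots,n\}$ not satisfying $P$. *)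

(* Defs.v *)
From mathcomp Require Import all_boot.
From mathcomp Require Import boolp classical_sets cardinality.

Set Implicit Arguments.
Unset Strict Implicit.
Unset Printing Implicit Defensive.

Local Open Scope classical_set_scope.
Local Open Scope nat_scope.

(* A property of positive integers is a set nat (i.e. nat -> Prop) whose      *)
(* value at 0 is irrelevant: neither notion below looks at it.                *)

Definition C (Q : set nat) (n : nat) : nat := \sum_(1 <= m < n.+1 | m \in Q) 1.

(* m is the n-th smallest positive integer in Q, n being counted from 1: it   *)
(* lies in Q and exactly n - 1 smaller positive integers do.                  *)
Definition is_nth_smallest (Q : set nat) (n m : nat) : Prop :=
  [/\ 0 < m, Q m & (C Q m.-1).+1 = n].

(* The default value 0, used when there is no n-th smallest element, is not   *)
(* a positive integer, so f Q n = k with 0 < k asserts that it exists.        *)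
Definition f (Q : set nat) (n : nat) : nat :=
  xget 0 [set m | is_nth_smallest Q n m].

(* Main.v *)
(* Write Q for the complement of P, k for the number of elements of Q up to n
   and g for the increasing enumeration of Q.  If Q has j elements up to N and
   also j elements up to N - 1, then N is the (N - j)-th element of P.  Take
   N = n + k with j = k when n + k < g (k + 1), and N = n + k + 1 with j = k + 1
   otherwise: there n < g (k + 1), so g (k + 2) >= g (k + 1) + k + 1 > N. *)
Require Import Defs.
From mathcomp Require Import all_boot.
From mathcomp Require Import boolp classical_sets cardinality.
From mathcomp Require Import zify.

Local Open Scope classical_set_scope.
Local Open Scope nat_scope.

Lemma C0 (Q : set nat) : C Q 0 = 0.
Proof. by rewrite /C big_geq. Qed.

Lemma CS (Q : set nat) (n : nat) : C Q n.+1 = C Q n + (n.+1 \in Q).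
Proof. by rewrite /C big_mkcond big_nat_recr //= -big_mkcond; case: ifP. Qed.

Lemma leq_C (Q : set nat) (m n : nat) : m <= n -> C Q m <= C Q n.
Proof.
by apply: (homo_leq leqnn (@leq_trans)) => k; rewrite CS leq_addr.
Qed.

Lemma C_setC (P : set nat) (n : nat) : C P n + C (~` P) n = n.
Proof.
by elim: n => [|n IHn]; rewrite ?C0 // !CS in_setC; case: (_ \in P); lia.
Qed.

(** The monotone count [C Q] steps from k - 1 to k exactly at [m]. Comparisons of counts thus become
    comparisons of positions. *)
Lemma is_nth_smallest_leq (Q : set nat) (k m n : nat) :
  is_nth_smallest Q k m -> (k <= C Q n) = (m <= n).
Proof.
case: m => [|m] [// _ /mem_set Qm /= <-].
by case: (leqP m.+1 n) => [|/ltnSE] /(leq_C Q); rewrite ?CS ?Qm; lia.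
Qed.

Lemma f_eq (Q : set nat) (k m : nat) : is_nth_smallest Q k m -> f Q k = m.
Proof.
move=> Qkm; apply: xget_unique => // m' Qkm'.
have := is_nth_smallest_leq Q k m m' Qkm.
have := is_nth_smallest_leq Q k m' m Qkm'.
rewrite (is_nth_smallest_leq Q k m m Qkm).
by rewrite (is_nth_smallest_leq Q k m' m' Qkm'); lia.
Qed.

Lemma f_gt0 (Q : set nat) (k : nat) : 0 < f Q k -> is_nth_smallest Q k (f Q k).
Proof. by rewrite /f; case: xgetP. Qed.

Lemma is_nth_smallest_f (Q : set nat) (k n : nat) :
  0 < k -> k <= C Q n -> is_nth_smallest Q k (f Q k).
Proof.
move=> k_gt0; elim: n => [|n IHn]; first by rewrite C0; lia.
case: (leqP k (C Q n)) => [/IHn //|lt_k]; rewrite CS.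
case: (boolP (n.+1 \in Q)) => [/set_mem Qn|_] le_k; last by lia.
suff Qkn : is_nth_smallest Q k n.+1 by rewrite (f_eq Q k n.+1 Qkn).
by split=> //=; lia.
Qed.

(** Equal counts at n + k - 1 and n + k put n + k in [P], with n - 1 elements of [P] before it. *)
Lemma f_setC (P : set nat) (n k : nat) : 0 < n ->
  C (~` P) (n + k).-1 = k -> C (~` P) (n + k) = k -> f P n = n + k.
Proof.
case: n => [//|n] _; rewrite addSn /= => Ck; rewrite CS Ck in_setC => Pk.
apply: f_eq; split=> //=; last by have := C_setC P (n + k); lia.
by apply/set_mem; case: (_ \in P) Pk => //=; lia.
Qed.

Theorem theorem2 (P : set nat)
  (P_fails_inf : infinite_set [set m : nat | 0 < m /\ ~ P m])
  (gap : forall m : nat, 0 < m -> m <= f (~` P) m.+1 - f (~` P) m)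
  (n : nat) (n_gt0 : 0 < n) :
  f P n = if f (~` P) (C (~` P) n).+1 <= n + C (~` P) n
          then n + C (~` P) n + 1
          else n + C (~` P) n.
Proof.
set Q := ~` P in gap *; set k := C Q n.
have le_kC m : n <= m -> k <= C Q m by exact: leq_C.
case: (leqP (f Q k.+1) (n + k)) => [le_g1|lt_g1].
- have gapk := gap k.+1 isT.
  (* The gap is positive, so truncated subtraction keeps [f Q k.+2] off the default 0. *)
  have nth2 : is_nth_smallest Q k.+2 (f Q k.+2) by apply: f_gt0; lia.
  (* So far [f Q k.+1] might be the default 0; a (k + 2)-th element forces a (k + 1)-th. *)
  have nth1 : is_nth_smallest Q k.+1 (f Q k.+1).
    apply: (is_nth_smallest_f _ _ (f Q k.+2)) => //; apply: ltnW.
    by rewrite (is_nth_smallest_leq _ _ _ _ nth2).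
  have g1_gt : k.+1 <= C Q n = (f Q k.+1 <= n) := is_nth_smallest_leq _ _ _ _ nth1.
  have C1 := is_nth_smallest_leq _ _ _ (n + k) nth1.
  have C2 := is_nth_smallest_leq _ _ _ (n + k).+1 nth2.
  have C12 := leq_C Q _ _ (leqnSn (n + k)).
  rewrite -/k ltnn in g1_gt.
  by rewrite -addnA addn1; apply: f_setC => //; rewrite ?addnS /= -/Q; lia.
- have nth1 : is_nth_smallest Q k.+1 (f Q k.+1) by apply: f_gt0; lia.
  have C1 := is_nth_smallest_leq _ _ _ (n + k) nth1.
  have Ck := le_kC (n + k) (leq_addr _ _).
  have C0k := leq_C Q _ _ (leq_pred (n + k)).
  apply: f_setC => //; rewrite -/Q; last by lia.
  (* If k = 0, then n + k - 1 < n and [le_kC] does not apply there, but the count is at most 0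
     anyway. *)
  case: (posnP k) => [k0|k_gt0]; first by lia.
  by have := le_kC (n + k).-1; lia.
Qed.
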